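(* The identity representation (i.e. the inclusion) of the inverse semigroup $T$ in $U[\mathbb{Z}]$ is tight.
   Context: $U[\mathbb{Z}]$ is the universal $C^*$-algebra generated by a set of unitaries $\{u^{n}:n\in\mathbb{Z}\}$ and a set of isometries $\{s_{m}:m\in\mathbb{Z}^{\times}\}$ ($\mathbb{Z}^{\times}$ = non-zero integers) satisfying $s_{m}s_{n}=s_{mn}$, $u^{n}u^{m}=u^{n+m}$, $s_{m}u^{n}=u^{mn}s_{m}$, and $\sum_{n\in\mathbb{Z}/(m)}u^{n}e_{m}u^{-n}=1$, where $e_{m}:=s_{m}s_{m}^{*}$. $T:=\{s_{m}^{*}u^{n}e_{k}u^{n'}s_{m'} : m,m',k \in \mathbb{Z}^{\times},\ n,n' \in \mathbb{Z}\}\cup\{0\}$, which is an inverse semigroup of partial isometries in $U[\mathbb{Z}]$ containing $0$ and $1$; its set of projections is $P:=\{u^{n}e_{m}u^{-n} : m\in\mathbb{Z}^{\times},\ n\in\mathbb{Z}\}\cup\{0\}$. Covers: let $E$ be an inverse semigroup of projections (commuting idempotents, ordered by $e\le f$ iff $ef=e$) containing $0,1$, and let $Z\subset E$. A subset $F\subset Z$ is a cover for $Z$ if for every non-zero $z\in Z$ there exists $f\in F$ with $fz\neq 0$; it is a finite cover if $F$ is finite. Tightness on semilattices: a representation $\sigma:E\to\mathcal{B}$ of the semilattice $E$ in a Boolean algebra $\mathcal{B}$ is tight if for every $x\in E$ and every finite cover $Z$ of the interval $[0,x]:=\{z\in E: z\le x\}$ one has $\sup_{z\in Z}\sigma(z)=\sigma(x)$.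 Tightness on inverse semigroups: let $A$ be a unital $C^*$-algebra, $S$ an inverse semigroup containing $0,1$ with set of projections $E$, and $\sigma:S\to A$ a unital representation of $S$ as partial isometries in $A$. Let $\mathcal{B}$ be the Boolean algebra of projections of the (unital, commutative) $C^*$-subalgebra of $A$ generated by $\sigma(E)$. The representation $\sigma$ is tight if $\sigma|_{E}:E\to\mathcal{B}$ is tight. *)

(* Defs.v *)
From HB Require Import structures.
From mathcomp Require Import all_boot all_order all_algebra.
From mathcomp Require Import complex.
From mathcomp Require Import boolp classical_sets functions cardinality reals.
From mathcomp Require Import topology normedtype.
From mathcomp Require Import ring lra zify.

Set Implicit Arguments.
Unset Strict Implicit.
Unset Printing Implicit Defensive.

Import Order.TTheory GRing.Theory Num.Theory numFieldNormedType.Exports.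

Local Open Scope classical_set_scope.
Local Open Scope ring_scope.
Local Open Scope complex_scope.

(* Nonzero unital C*-algebras over the complex numbers [R[i]].  Hierarchy-Builder
   cannot join the library's algebras with its normed modules (NumDomain
   already inherits from both), so the product is a field over a complete
   normed module; the carrier then receives both canonical structures, as
   matrices do in the library.  Norms take their values in [R[i]]. *)
Record cstarAlgebra (R : realType) := CStarAlgebra {
  cstar_normedMod : completeNormedModType R[i];
  cstar_one : cstar_normedMod;
  cstar_mul : cstar_normedMod -> cstar_normedMod -> cstar_normedMod;
  cstar_star : cstar_normedMod -> cstar_normedMod;
  cstar_mulA : associative cstar_mul;
  cstar_mul1l : left_id cstar_one cstar_mul;
  cstar_mul1r : right_id cstar_one cstar_mul;
  cstar_mulDl : left_distributive cstar_mul +%R;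
  cstar_mulDr : right_distributive cstar_mul +%R;
  cstar_one_neq0 : cstar_one != 0;
  cstar_scaleAl : forall (k : R[i]) (a b : cstar_normedMod),
    k *: cstar_mul a b = cstar_mul (k *: a) b;
  cstar_scaleAr : forall (k : R[i]) (a b : cstar_normedMod),
    k *: cstar_mul a b = cstar_mul a (k *: b);
  cstar_normM : forall a b : cstar_normedMod,
    `|cstar_mul a b| <= `|a| * `|b|;
  cstar_starD : {morph cstar_star : a b / a + b};
  cstar_starZ : forall (k : R[i]) (a : cstar_normedMod),
    cstar_star (k *: a) = k^* *: cstar_star a;
  cstar_starM : forall a b : cstar_normedMod,
    cstar_star (cstar_mul a b) = cstar_mul (cstar_star b) (cstar_star a);
  cstar_starK : involutive cstar_star;
  cstar_norm_starM : forall a : cstar_normedMod,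
    `|cstar_mul (cstar_star a) a| = `|a| ^+ 2
}.

Definition cstar_sort (R : realType) (A : cstarAlgebra R) : Type :=
  cstar_normedMod A.

Coercion cstar_sort : cstarAlgebra >-> Sortclass.

HB.instance Definition _ (R : realType) (A : cstarAlgebra R) :=
  CompleteNormedModule.on (cstar_sort A).
HB.instance Definition _ (R : realType) (A : cstarAlgebra R) :=
  GRing.Zmodule_isNzRing.Build (cstar_sort A) (@cstar_mulA R A)
    (@cstar_mul1l R A) (@cstar_mul1r R A) (@cstar_mulDl R A)
    (@cstar_mulDr R A) (@cstar_one_neq0 R A).
HB.instance Definition _ (R : realType) (A : cstarAlgebra R) :=
  GRing.Lmodule_isLalgebra.Build R[i] (cstar_sort A) (@cstar_scaleAl R A).
HB.instance Definition _ (R : realType) (A : cstarAlgebra R) :=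
  GRing.Lalgebra_isAlgebra.Build R[i] (cstar_sort A) (@cstar_scaleAr R A).

Definition star (R : realType) (A : cstarAlgebra R) : A -> A :=
  @cstar_star R A.


Section CStarTheory.
Variables (R : realType) (A : cstarAlgebra R).
Implicit Types (a b c p q : A) (k : R[i]).

Lemma starD a b : star (a + b) = star a + star b. Proof. exact: cstar_starD. Qed.
Lemma starZ k a : star (k *: a) = (k^*) *: star a. Proof. exact: cstar_starZ. Qed.
Lemma starM a b : star (a * b) = star b * star a. Proof. exact: cstar_starM. Qed.
Lemma starK a : star (star a) = a. Proof. exact: cstar_starK. Qed.
Lemma normM_le a b : `|a * b| <= `|a| * `|b|. Proof. exact: cstar_normM. Qed.
Lemma norm_starM a : `|star a * a| = `|a| ^+ 2. Proof. exact: cstar_norm_starM. Qed.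

Lemma star0 : star (0 : A) = 0.
Proof. by apply: (addrI (star 0)); rewrite -starD !addr0. Qed.

Lemma starN a : star (- a) = - star a.
Proof. by apply: (addrI (star a)); rewrite -starD !subrr star0. Qed.

Lemma star1 : star (1 : A) = 1.
Proof. by rewrite -[LHS]mulr1 -{2}[1]starK -starM mulr1 starK. Qed.

Lemma star_sum (I : Type) (r : seq I) (P : pred I) (F : I -> A) :
  star (\sum_(i <- r | P i) F i) = \sum_(i <- r | P i) star (F i).
Proof. exact: (big_morph _ starD star0). Qed.

End CStarTheory.

Section Projections.
Variables (R : realType) (A : cstarAlgebra R).
Implicit Types (a b c p q : A) (k : R[i]).

Definition is_projection p : Prop := star p = p /\ p * p = p.
Definition partial_isometry a : Prop := a * star a * a = a.

Lemma norm_proj_le1 p : is_projection p -> `|p| <= 1.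
Proof.
case=> ps pp; have := norm_starM p; rewrite ps pp => E.
have [->|p0] := eqVneq p 0; first by rewrite normr0.
have n0 : `|p| != 0 by rewrite normr_eq0.
by have := congr1 ( *%R^~ `|p|^-1) E; rewrite /= expr2 mulfK // divff // => <-.
Qed.

Lemma normM_le1 a b : `|a| <= 1 -> `|b| <= 1 -> `|a * b| <= 1.
Proof. by move=> *; apply: le_trans (normM_le _ _) (mulr_ile1 _ _ _ _). Qed.

Lemma norm_star_eq0 a : star a * a = 0 -> a = 0.
Proof.
move=> E; have := norm_starM a; rewrite E normr0 => /esym/eqP.
by rewrite sqrf_eq0 normr_eq0 => /eqP.
Qed.

Lemma norm_le0_archi (V : normedModType R[i]) (v : V) :
  (forall t, `|v| *+ t.+1 <= 1) -> v = 0.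
Proof.
move=> H; apply/eqP; rewrite -normr_eq0.
have n0 : 0 <= `|v| by [].
have E : `|v| = (complex.Re `|v|)%:C.
  by rewrite RRe_real // ger0_real.
set r := complex.Re `|v| in E.
have r0 : 0 <= r by move: n0; rewrite E lecR.
rewrite E eq_complex /= eqxx andbT; apply/eqP/le_anti; rewrite r0 andbT.
rewrite leNgt; apply/negP => rp.
have := archi_boundP (ltW (etrans (invr_gt0 r) rp)).
case: (Num.bound _) => [|t] ht.
  by have := lt_trans ht (etrans (invr_gt0 r) rp); rewrite ltxx.
have := H t; rewrite E -rmorphMn /= -[1]/(1%:C) lecR -mulr_natr.
by rewrite leNgt => /negP; apply; rewrite mulrC -ltr_pdivrMr // div1r.
Qed.

Lemma norm_le_eps (V : normedModType R[i]) (v : V) (k : R[i]) :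
  (forall e, 0 < e -> `|v| <= e * k) -> v = 0.
Proof.
move=> H; apply/eqP; rewrite -normr_eq0; apply/eqP/le_anti; rewrite normr_ge0.
rewrite andbT; have k0 : 0 <= k.
  by have := H 1 ltr01; rewrite mul1r; apply: le_trans.
have [vz|] := eqVneq `|v| 0; first by rewrite vz.
rewrite -normr_gt0 normr_id => v0.
have k1 : 0 < k + k + 1 by rewrite ltr_wpDl ?addr_ge0.
have := H (`|v| / (k + k + 1)) (divr_gt0 v0 k1).
rewrite -mulrA ler_pMr // mulrC ler_pdivlMr // mul1r => h.
have : k + 1 <= 0 by rewrite -(lerD2l k) addr0 addrA.
by move=> /(le_trans (_ : 1 <= k + 1)); rewrite lerDr ler10 => /(_ k0).
Qed.

(* A projection [q] is an extreme point of the unit ball of [qAq]. *)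
Lemma proj_extreme q c : is_projection q -> q * c = c -> c * q = c ->
  `|q + c| <= 1 -> `|q - c| <= 1 -> c = 0.
Proof.
move=> pq qc cq Hp Hm; have [_ qq] := pq.
have bound (t : R) n (a : R) : 0 < t ->
    `|c *+ n + a%:C *: q| * (2 * t)%:C <= (n%:R + a ^+ 2 + t ^+ 2)%:C.
  move=> t0; elim: n a => [|n IH] a.
    rewrite mulr0n !add0r normrZ normc_def /= expr0n /= addr0 sqrtr_sqr.
    apply: (@le_trans _ _ (`|a|%:C * (2 * t)%:C)).
      apply: ler_wpM2r; first by rewrite lecR mulr_ge0 // ltW.
      by rewrite ler_piMr ?norm_proj_le1 // lecR.
    rewrite -rmorphM /= lecR -[a ^+ 2]real_normK ?num_real //.
    have := sqr_ge0 (`|a| - t); set b := `|a|; move=> h; nra.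
  have [y ey] : exists y, y = c *+ n + a%:C *: q by exists (c *+ n + a%:C *: q).
  have yp : c *+ n + (a + 1)%:C *: q = y + q.
    by rewrite rmorphD rmorph1 scalerDl scale1r addrA ey.
  have ym : c *+ n + (a - 1)%:C *: q = y - q.
    by rewrite rmorphB rmorph1 scalerBl scale1r addrA ey.
  have qy : q * y = y by rewrite ey mulrDr mulrnAr -scalerAr qc qq.
  have E : (c *+ n.+1 + a%:C *: q) *+ 2 = (q + c) * (y + q) + (q - c) * (y - q).
    rewrite mulrDl mulrBl !mulrBr !mulrDr qy qq cq.
    rewrite [c *+ n.+1]mulrSr [in LHS]addrAC -ey [c * y + c]addrC.
    rewrite opprB [RHS]addrACA [X in _ = X + _]addrACA subrr addr0.
    by rewrite [X in _ = _ + X]addrACA subrr addr0 -mulr2n -mulr2n mulrnDl.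
  have := ler_normD ((q + c) * (y + q)) ((q - c) * (y - q)).
  rewrite -E normrMn => /le_trans H.
  have {H} H : `|c *+ n.+1 + a%:C *: q| *+ 2 <= `|y + q| + `|y - q|.
    apply: H; apply: lerD; apply: le_trans (normM_le _ _) _;
    by rewrite ler_piMl.
  have t2 : 0 <= (2 * t)%:C by rewrite lecR mulr_ge0 // ltW.
  have := lerD (IH (a + 1)) (IH (a - 1)); rewrite yp ym -mulrDl.
  move/(le_trans (ler_wpM2r t2 H)).
  have -> : (n%:R + (a + 1) ^+ 2 + t ^+ 2)%:C + (n%:R + (a - 1) ^+ 2 + t ^+ 2)%:C
      = (n.+1%:R + a ^+ 2 + t ^+ 2)%:C * 2%:R :> R[i].
    by rewrite -rmorphD -(rmorph_nat (real_complex R)) -rmorphM -natr1;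
      congr (_%:C); ring.
  by rewrite [X in X <= _ -> _]mulrnAl -[X in X <= _ -> _]mulr_natr ler_pM2r // ltr0n.
apply: norm_le0_archi => t.
have := bound t.+1%:R (t.+1 ^ 2)%N 0 (ltr0Sn _ _).
rewrite scale0r addr0 normrMn expr0n addr0 natrX.
have -> : t.+1%:R ^+ 2 + t.+1%:R ^+ 2 = t.+1%:R * (2 * t.+1%:R) :> R by ring.
have t2 : 0 < (2 * t.+1%:R)%:C :> R[i] by rewrite ltcR mulr_gt0.
rewrite [X in _ <= X -> _]rmorphM ler_pM2r // => {bound t2}.
rewrite -mulnn mulrnA => H.
have : `|c| *+ t.+1 *+ t.+1 <= 1 *+ t.+1 by rewrite -(rmorph_nat (real_complex R)).
by rewrite lerMn2r.
Qed.

Lemma proj_mul_eq0 p q : is_projection p -> is_projection q ->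
  q * p * q = 0 -> p * q = 0.
Proof.
case=> ps pp [qs qq] E; apply: norm_star_eq0.
by rewrite starM ps qs mulrA -(mulrA q) pp.
Qed.

Lemma proj_sum_orth (I : finType) (p : I -> A) (i j : I) :
  (forall i, is_projection (p i)) -> \sum_i p i = 1 -> i != j -> p i * p j = 0.
Proof.
move=> Hp Hs ij; apply: proj_mul_eq0 => //.
set q := p j; have pq : is_projection q by exact: Hp.
have [qs qq] := pq.
pose a l := q * p l * q.
have aq l : a l * q = a l by rewrite /a -!mulrA qq.
have qa l : q * a l = a l by rewrite /a !mulrA qq.
have Hb l : `|q - a l *+ 2| <= 1.
  have -> : q - a l *+ 2 = q * (1 - p l *+ 2) * q.
    by rewrite mulrBr mulrBl mulr1 qq mulrnAr mulrnAl.
  have q1 := norm_proj_le1 pq.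
  have v1 : `|1 - p l *+ 2| <= 1.
    have [pls pll] := Hp l.
    have : `|star (1 - p l *+ 2) * (1 - p l *+ 2)| <= 1.
      have xs : star (p l *+ 2) = p l *+ 2 by rewrite mulr2n starD pls.
      have xx : p l *+ 2 * (p l *+ 2) = p l *+ 2 + p l *+ 2.
        by rewrite mulrnAr mulrnAl pll -[RHS]mulr2n.
      rewrite starD starN xs star1 mulrBr mulr1 mulrBl mul1r xx.
      rewrite opprB addrK subrK.
      by have := norm_proj_le1 (conj (star1 A) (mul1r 1)).
    by rewrite norm_starM expr_le1.
  by do 2?apply: normM_le1.
have Ha : \sum_(l | l != j) a l = 0.
  have : \sum_l a l = q by rewrite -mulr_suml -mulr_sumr Hs mulr1 qq.
  rewrite (bigD1 j) //= /a qq qq => /(canRL (addKr _)).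
  by rewrite addNr.
have Hk : \sum_(l | (l != j) && (l != i)) (q - a l *+ 2)
   = q *+ #|[pred l | (l != j) && (l != i)]| + a i *+ 2.
  rewrite big_split /= sumr_const; congr (_ + _).
  rewrite sumrN sumrMnl -mulNrn; congr (_ *+ _).
  by move: Ha; rewrite (bigD1 i) //= => /eqP; rewrite addr_eq0 => /eqP ->.
set k := #|_| in Hk.
have Hn : `|q *+ k + a i *+ 2| <= k%:R.
  rewrite -Hk; apply: le_trans (ler_norm_sum _ _ _) _.
  by apply: le_trans (ler_sum _ (fun l _ => Hb l)) _; rewrite sumr_const.
pose s : R[i] := k.+1%:R^-1.
have s0 : 0 <= s by rewrite invr_ge0.
have sk : s * (k%:R + 1) = 1 by rewrite natr1 mulVf // pnatr_eq0.
have sq : q = s *: (q *+ k + q).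
  by rewrite -mulrSr -scaler_nat scalerA mulVf ?pnatr_eq0 // scale1r.
suff : s *: (a i *+ 2) = 0.
  move/eqP; rewrite scaler_eq0 invr_eq0 pnatr_eq0 /= -scaler_nat scaler_eq0.
  by rewrite pnatr_eq0 => /eqP.
apply: (proj_extreme pq).
- by rewrite -scalerAr mulrnAr qa.
- by rewrite -scalerAl mulrnAl aq.
- rewrite {1}sq -scalerDr addrAC normrZ ger0_norm // -sk ler_wpM2l //.
  by apply: le_trans (ler_normD _ _) (lerD Hn (norm_proj_le1 pq)).
- rewrite {1}sq -scalerBr -addrA normrZ ger0_norm // -sk ler_wpM2l //.
  apply: le_trans (ler_normD _ _) (lerD _ (Hb i)).
  by rewrite normrMn ler_wMn2r // norm_proj_le1.
Qed.

End Projections.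

Section Subalgebras.
Variables (R : realType) (A : cstarAlgebra R).
Implicit Types (a b c p q : A) (D X Y : set A).

Definition is_cstar_subalg D : Prop :=
  [/\ closed D, D 1,
      forall (k : R[i]) a b, D a -> D b -> D (k *: a + b),
      forall a b, D a -> D b -> D (a * b) &
      forall a, D a -> D (star a)].

Definition cstar_gen X : set A := smallest is_cstar_subalg X.

Lemma cstar_gen_min X D : is_cstar_subalg D -> X `<=` D -> cstar_gen X `<=` D.
Proof. by move=> HD XD a; apply. Qed.

Lemma cstar_gen_subalg X : is_cstar_subalg (cstar_gen X).
Proof.
split.
- by apply: closed_bigI => D [[]].
- by move=> D [[]].
- move=> k a b Da Db D HD; case: (HD) => -[_ _ H _ _] _;
  by apply: H; [apply: Da | apply: Db].
- move=> a b Da Db D HD; case: (HD) => -[_ _ _ H _] _;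
  by apply: H; [apply: Da | apply: Db].
- by move=> a Da D HD; case: (HD) => -[_ _ _ _ H] _; apply: H; apply: Da.
Qed.

Definition commutant Y : set A := [set a | forall y, Y y -> a * y = y * a].

Lemma commutant_subalg Y : (forall y, Y y -> Y (star y)) ->
  is_cstar_subalg (commutant Y).
Proof.
move=> HY; split.
- apply/closure_id/seteqP; split; first exact: subset_closure.
  move=> a cla y Yy; apply/eqP; rewrite -subr_eq0; apply/eqP.
  apply: (@norm_le_eps _ A _ (`|y| + `|y|)) => e e0.
  have [b [Hb]] := cla _ (nbhsx_ballx a _ e0).
  rewrite -ball_normE /= => ab.
  have -> : a * y - y * a = (a - b) * y - y * (a - b).
    by rewrite mulrBl mulrBr (Hb _ Yy) opprB addrA subrK.
  apply: le_trans (ler_normB _ _) _; rewrite [leRHS]mulrDr; apply: lerD.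
    by apply: le_trans (normM_le _ _) _; rewrite ler_wpM2r // ltW.
  by apply: le_trans (normM_le _ _) _; rewrite mulrC ler_wpM2r // ltW.
- by move=> y _; rewrite mulr1 mul1r.
- move=> k a b Ha Hb y Yy.
  by rewrite mulrDl mulrDr -scalerAl -scalerAr Ha // Hb.
- by move=> a b Ha Hb y Yy; rewrite -mulrA Hb // mulrA Ha // mulrA.
- by move=> a Ha y Yy; rewrite -[y]starK -!starM Ha //; exact: HY.
Qed.

Lemma cstar_gen_comm X :
  (forall x, X x -> star x = x) -> (forall x y, X x -> X y -> x * y = y * x) ->
  forall a b, cstar_gen X a -> cstar_gen X b -> a * b = b * a.
Proof.
move=> sX cX.
have X1 : cstar_gen X `<=` commutant X.
  apply: cstar_gen_min; last by move=> x Xx y; exact: cX.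
  by apply: commutant_subalg => y Xy; rewrite sX.
have [_ _ _ _ gs] := cstar_gen_subalg X.
have X2 : cstar_gen X `<=` commutant (cstar_gen X).
  apply: cstar_gen_min; first exact: commutant_subalg.
  by move=> x Xx y /X1 /(_ _ Xx).
by move=> a b Ha Hb; exact: X2.
Qed.

End Subalgebras.

Record commSubalgebra (R : realType) (A : cstarAlgebra R) := CommSubalgebra {
  csub_set : set A;
  csub_subalg : is_cstar_subalg csub_set;
  csub_comm : forall a b, csub_set a -> csub_set b -> a * b = b * a
}.

Definition projections (R : realType) (A : cstarAlgebra R)
  (D : commSubalgebra A) : Type := {p : A | `[< csub_set D p /\ is_projection p >]}.

Section ProjectionLattice.
Variables (R : realType) (A : cstarAlgebra R) (D : commSubalgebra A).

HB.instance Definition _ :=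
  [isSub for @sval A (fun p => `[< csub_set D p /\ is_projection p >])
    : projections D -> A].
HB.instance Definition _ := [Choice of projections D by <:].

Implicit Types (x y z : projections D).

Lemma projectionsP x : csub_set D (val x) /\ is_projection (val x).
Proof. exact/asboolP/(valP x). Qed.

Definition Projection p (Hp : csub_set D p /\ is_projection p) : projections D :=
  exist _ p (asboolT Hp).

Lemma csubC x y : val x * val y = val y * val x.
Proof.
have [Dx _] := projectionsP x; have [Dy _] := projectionsP y.
exact: csub_comm Dx Dy.
Qed.

Lemma proj_val_idem x : val x * val x = val x.
Proof. by have [_ []] := projectionsP x. Qed.

Lemma meet_subproof x y : csub_set D (val x * val y) /\ is_projection (val x * val y).
Proof.
have [Dx [sx xx]] := projectionsP x; have [Dy [sy yy]] := projectionsP y.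
have [_ _ _ HM _] := csub_subalg D.
split; first exact: HM.
split; first by rewrite starM sx sy csubC.
by rewrite mulrA -(mulrA _ _ (val x)) (csubC y x) mulrA xx -mulrA yy.
Qed.

Lemma compl_subproof x : csub_set D (1 - val x) /\ is_projection (1 - val x).
Proof.
have [Dx [sx xx]] := projectionsP x; have [_ H1 HL _ _] := csub_subalg D.
split; first by rewrite addrC -scaleN1r; apply: HL.
split; first by rewrite starD starN star1 sx.
by rewrite mulrBr mulr1 mulrBl mul1r xx subrr subr0.
Qed.

Lemma bot_subproof : csub_set D 0 /\ is_projection (0 : A).
Proof.
have [_ H1 HL _ _] := csub_subalg D; split.
  by have := HL (-1) _ _ H1 H1; rewrite scaleN1r addNr.
by split; rewrite ?star0 ?mulr0.
Qed.

Lemma top_subproof : csub_set D 1 /\ is_projection (1 : A).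
Proof.
have [_ H1 _ _ _] := csub_subalg D; split=> //.
by split; rewrite ?star1 ?mulr1.
Qed.

Definition proj_meet x y : projections D := Projection (meet_subproof x y).
Definition proj_compl x : projections D := Projection (compl_subproof x).
Definition proj_bot : projections D := Projection (bot_subproof).
Definition proj_top : projections D := Projection (top_subproof).
Definition proj_join x y :=
  proj_compl (proj_meet (proj_compl x) (proj_compl y)).
Definition proj_le : rel (projections D) :=
  fun x y => val x * val y == val x.
Definition proj_lt : rel (projections D) :=
  fun x y => (y != x) && proj_le x y.

Lemma val_meet x y : val (proj_meet x y) = val x * val y. Proof. by []. Qed.
Lemma val_compl x : val (proj_compl x) = 1 - val x. Proof. by []. Qed.
Lemma val_join x y : val (proj_join x y) = val x + val y - val x * val y.
Proof.
rewrite /proj_join !(val_compl, val_meet) mulrBl mul1r mulrBr mulr1.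
by rewrite !opprB addrC !addrA subrK addrAC.
Qed.

Fact proj_le_def x y : proj_le x y = (proj_meet x y == x).
Proof. by []. Qed.
Fact proj_meetC : commutative proj_meet.
Proof. by move=> x y; apply: val_inj; exact: csubC. Qed.
Fact proj_joinC : commutative proj_join.
Proof. by move=> x y; rewrite /proj_join proj_meetC. Qed.
Fact proj_meetA : associative proj_meet.
Proof. by move=> x y z; apply: val_inj; rewrite /= mulrA. Qed.
Fact proj_complK : involutive proj_compl.
Proof. by move=> x; apply: val_inj; rewrite /= opprB addrC subrK. Qed.
Fact proj_joinA : associative proj_join.
Proof. by move=> x y z; rewrite /proj_join !proj_complK proj_meetA. Qed.
Fact proj_joinKI y x : proj_meet x (proj_join x y) = x.
Proof.
apply: val_inj; rewrite val_meet val_join mulrBr mulrDr mulrA.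
by rewrite proj_val_idem addrK.
Qed.
Fact proj_meetKU y x : proj_join x (proj_meet x y) = x.
Proof.
by apply: val_inj; rewrite val_join val_meet mulrA proj_val_idem addrK.
Qed.
Fact proj_meetxx : idempotent_op proj_meet.
Proof. by move=> x; apply: val_inj; exact: proj_val_idem. Qed.
Fact proj_meetUl : left_distributive proj_meet proj_join.
Proof.
move=> x y z; apply: val_inj; rewrite val_join !val_meet val_join.
rewrite mulrBl mulrDl; congr (_ - _); rewrite -!mulrA; congr (_ * _).
by rewrite mulrA (csubC z y) -mulrA proj_val_idem.
Qed.

Fact proj_display : Order.disp_t. Proof. exact: Order.Disp tt tt. Qed.

HB.instance Definition _ := @Order.isMeetJoinDistrLattice.Build proj_display
  (projections D) proj_le proj_lt proj_meet proj_join proj_le_def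
  (fun _ _ => erefl) proj_meetC proj_joinC proj_meetA proj_joinA
  proj_joinKI proj_meetKU proj_meetUl proj_meetxx.

Fact proj_le0x x : (proj_bot <= x :> projections D)%O.
Proof. by rewrite leEmeet; apply/eqP/val_inj; rewrite /= mul0r. Qed.
Fact proj_lex1 x : (x <= proj_top)%O.
Proof. by rewrite leEmeet; apply/eqP/val_inj; rewrite /= mulr1. Qed.

HB.instance Definition _ :=
  Order.hasBottom.Build proj_display (projections D) proj_le0x.
HB.instance Definition _ :=
  Order.hasTop.Build proj_display (projections D) proj_lex1.

Fact proj_joinxC x : (x `|` proj_compl x = \top)%O.
Proof.
apply: val_inj; rewrite [LHS]val_join val_compl mulrBr mulr1 proj_val_idem.
by rewrite subrr subr0 addrC subrK.
Qed.
Fact proj_meetxC x : (x `&` proj_compl x = \bot)%O.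
Proof.
by apply: val_inj; rewrite [LHS]val_meet val_compl mulrBr mulr1 proj_val_idem subrr.
Qed.

HB.instance Definition _ := Order.TBDistrLattice_hasComplement.Build
  proj_display (projections D) proj_joinxC proj_meetxC.

End ProjectionLattice.


(* Inverse semigroups with zero and unit: [sinvP] states that [sinv x] is the
   one and only generalized inverse of [x]. *)
HB.mixin Record Monoid_isInverseSemigroup S of Monoid S := {
  szero : S;
  mul0s : forall x : S, (szero * x = szero)%g;
  muls0 : forall x : S, (x * szero = szero)%g;
  sinv : S -> S;
  sinvP : forall x y : S,
    ((x * y * x = x) /\ (y * x * y = y) <-> y = sinv x)%g
}.

#[short(type="inverseSemigroupType")]
HB.structure Definition InverseSemigroup :=
  {S of Monoid S & Monoid_isInverseSemigroup S}.

Definition idempotents (S : inverseSemigroupType) : Type :=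
  {e : S | (e * e)%g == e}.

Section Idempotents.
Variable S : inverseSemigroupType.

HB.instance Definition _ :=
  [isSub for @sval S (fun e => (e * e)%g == e) : idempotents S -> S].
HB.instance Definition _ := [Choice of idempotents S by <:].

Implicit Types (x y z : idempotents S) (e f g : S).

Lemma idemP x : (val x * val x = val x)%g.
Proof. exact/eqP/(valP x). Qed.

Lemma sinv_idem e : (e * e = e)%g -> sinv e = e.
Proof. by move=> ee; symmetry; apply/sinvP; rewrite !ee. Qed.

Lemma mul_idem e f : (e * e = e -> f * f = f -> (e * f) * (e * f) = e * f)%g.
Proof.
move=> ee ff; have [] := (sinvP (e * f)%g (sinv (e * f)%g)).2 erefl.
set g := sinv _ => h1 h2.
have hg : (f * g * e)%g = g.
  apply/sinvP; split.
    suff -> : (e * f * (f * g * e) * (e * f) = e * f * g * (e * f))%g by [].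
    by rewrite -!mulgA (mulgA f f) ff (mulgA e e) ee.
  suff -> : (f * g * e * (e * f) * (f * g * e) = f * (g * (e * f) * g) * e)%g.
    by rewrite h2.
  by rewrite -!mulgA (mulgA f f) ff (mulgA e e) ee.
have gg : (g * g = g)%g.
  suff -> : (g * g = f * (g * (e * f) * g) * e)%g by rewrite h2.
  by rewrite -{1 2}hg -!mulgA.
have E : (e * f)%g = sinv g by apply/sinvP.
by rewrite E (sinv_idem gg) gg.
Qed.

Lemma idem_comm e f : (e * e = e -> f * f = f -> e * f = f * e)%g.
Proof.
move=> ee ff; have h1 := mul_idem ee ff; have h2 := mul_idem ff ee.
rewrite -[LHS](sinv_idem h1); symmetry; apply/sinvP; split.
  by rewrite -[RHS]h1 -!mulgA (mulgA f f) ff (mulgA e e) ee.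
by rewrite -[RHS]h2 -!mulgA (mulgA e e) ee (mulgA f f) ff.
Qed.

Definition Idempotent e (He : (e * e = e)%g) : idempotents S :=
  exist _ e (introT eqP He).

Definition idem_meet x y := Idempotent (mul_idem (idemP x) (idemP y)).
Definition idem_bot := Idempotent (mul0s (szero : S)).
Definition idem_top := Idempotent (mulg1 (1%g : S)).
Definition idem_le : rel (idempotents S) := fun x y => idem_meet x y == x.
Definition idem_lt : rel (idempotents S) := fun x y => (y != x) && idem_le x y.

Fact idem_meetC : commutative idem_meet.
Proof. by move=> x y; apply: val_inj; exact: idem_comm (idemP x) (idemP y). Qed.
Fact idem_meetA : associative idem_meet.
Proof. by move=> x y z; apply: val_inj; exact: mulgA. Qed.
Fact idem_meetxx : idempotent_op idem_meet.
Proof. by move=> x; apply: val_inj; exact: idemP. Qed.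
Fact idem_le_refl : reflexive idem_le.
Proof. by move=> x; apply/eqP; exact: idem_meetxx. Qed.
Fact idem_le_anti : antisymmetric idem_le.
Proof. by move=> x y /andP[/eqP xy /eqP yx]; rewrite -[LHS]xy idem_meetC yx. Qed.
Fact idem_le_trans : transitive idem_le.
Proof.
move=> y x z /eqP xy /eqP yz; apply/eqP.
by rewrite -{1}xy -idem_meetA yz xy.
Qed.

Fact idem_display : Order.disp_t. Proof. exact: Order.Disp tt tt. Qed.

HB.instance Definition _ := Order.isPOrder.Build idem_display (idempotents S)
  (fun _ _ => erefl : idem_lt _ _ = _) idem_le_refl idem_le_anti idem_le_trans.
HB.instance Definition _ := Order.POrder_Meet_isSemilattice.Build idem_display
  (idempotents S) idem_meetC idem_meetA (fun _ _ => erefl).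

Fact idem_le0x x : (idem_bot <= x)%O.
Proof. by apply/eqP/val_inj; exact: mul0s. Qed.
Fact idem_lex1 x : (x <= idem_top)%O.
Proof. by apply/eqP/val_inj; exact: mulg1. Qed.

HB.instance Definition _ :=
  Order.hasBottom.Build idem_display (idempotents S) idem_le0x.
HB.instance Definition _ :=
  Order.hasTop.Build idem_display (idempotents S) idem_lex1.

End Idempotents.

Section SemilatticeTight.
Context {d d' : Order.disp_t}.
Variables (E : tbMeetSemilatticeType d) (B : ctbDistrLatticeType d').
Local Open Scope order_scope.

Definition is_cover (Z F : set E) : Prop :=
  F `<=` Z /\
  forall z, Z z -> z != \bot -> exists2 f, F f & f `&` z != \bot.

Record semilattice_rep := SemilatticeRep {
  srep_fun :> E -> B;
  srepI : {morph srep_fun : x y / x `&` y};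
  srep0 : srep_fun \bot = \bot
}.

(* A finite cover is given as a list; the supremum of the empty list is [\bot]. *)
Definition semilattice_tight (sigma : semilattice_rep) : Prop :=
  forall (x : E) (Z : seq E), is_cover [set z | z <= x] [set` Z] ->
    \join_(z <- Z) sigma z = sigma x.

End SemilatticeTight.

Section SemigroupTight.
Variables (S : inverseSemigroupType) (R : realType) (A : cstarAlgebra R).

Record semigroup_rep := SemigroupRep {
  rep_fun :> S -> A;
  rep_pisom : forall x, partial_isometry (rep_fun x);
  repM : forall x y, rep_fun (x * y)%g = rep_fun x * rep_fun y;
  repV : forall x, rep_fun (sinv x) = star (rep_fun x);
  rep0 : rep_fun szero = 0;
  rep1 : rep_fun 1%g = 1
}.

Variable sigma : semigroup_rep.

Definition rep_projections : set A :=
  range (fun e : idempotents S => sigma (val e)).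

Lemma rep_idem_proj (e : idempotents S) : is_projection (sigma (val e)).
Proof. by split; rewrite -?repV -?repM ?(sinv_idem (idemP e)) ?idemP. Qed.

Lemma rep_projections_star a : rep_projections a -> star a = a.
Proof. by case=> e _ <-; have [] := rep_idem_proj e. Qed.

Lemma rep_projections_comm a b :
  rep_projections a -> rep_projections b -> a * b = b * a.
Proof.
by case=> e _ <- [f _ <-]; rewrite -!repM (idem_comm (idemP e) (idemP f)).
Qed.

Definition rep_csub : commSubalgebra A := CommSubalgebra
  (cstar_gen_subalg rep_projections)
  (cstar_gen_comm rep_projections_star rep_projections_comm).

Lemma rep_idem_subproof (e : idempotents S) :
  csub_set rep_csub (sigma (val e)) /\ is_projection (sigma (val e)).
Proof.
by split; [apply: sub_gen_smallest; exists e | exact: rep_idem_proj].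
Qed.

Definition rep_idem_fun (e : idempotents S) : projections rep_csub :=
  Projection (rep_idem_subproof e).

Lemma rep_idemI : {morph rep_idem_fun : x y / (x `&` y)%O}.
Proof. by move=> x y; apply: val_inj; exact: repM. Qed.

Lemma rep_idem0 : rep_idem_fun \bot%O = \bot%O.
Proof. by apply: val_inj; exact: rep0. Qed.

Definition rep_idem := SemilatticeRep rep_idemI rep_idem0.

Definition tight : Prop := semilattice_tight rep_idem.

End SemigroupTight.

(* Indices [m] of [s] are meant to be non-zero; [s 0] is irrelevant. *)
Definition range_proj (R : realType) (A : cstarAlgebra R) (s : int -> A)
  (m : int) : A := s m * star (s m).

(* The sum ranges over the representatives [0 <= n < `|m|] of [Z/(m)]; by the
   relation [s m * u n = u (m * n) * s m] its terms depend only on [n] mod [m]. *)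
Record UZ_relations (R : realType) (A : cstarAlgebra R) (u s : int -> A)
    : Prop := UZRelations {
  u_unitary : forall n, star (u n) * u n = 1 /\ u n * star (u n) = 1;
  s_isometry : forall m, m != 0 -> star (s m) * s m = 1;
  smuls : forall m n, m != 0 -> n != 0 -> s m * s n = s (m * n);
  umulu : forall n m, u n * u m = u (n + m);
  smulu : forall m n, m != 0 -> s m * u n = u (m * n) * s m;
  sum_range : forall m, m != 0 ->
    \sum_(n < `|m|%N) u n%:Z * range_proj s m * u (- n%:Z) = 1
}.

Definition UZ_T (R : realType) (A : cstarAlgebra R) (u s : int -> A) : set A :=
  [set t | t = 0 \/ exists m m' k n n', [/\ m != 0, m' != 0, k != 0 &
    t = star (s m) * u n * range_proj s k * u n' * s m']].

Section UZTheory.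
Variables (R : realType) (A : cstarAlgebra R) (u s : int -> A).
Hypothesis H : UZ_relations u s.
Implicit Types m n k l a b : int.

(* Kept abstract so that rewriting does not see through them. *)
Variables (e : int -> A) (P : int -> int -> A).
Hypothesis eE : forall m, e m = s m * star (s m).
Hypothesis PE : forall m n, P m n = u n * e m * u (- n).

Lemma rpE m : range_proj s m = e m. Proof. by rewrite eE. Qed.

Lemma u0 : u 0 = 1.
Proof.
have [h _] := u_unitary H 0.
by rewrite -[u 0]mul1r -{1}h -mulrA (umulu H) addr0.
Qed.

Lemma s1 : s 1 = 1.
Proof.
have h := s_isometry H (oner_neq0 _).
by rewrite -[s 1]mul1r -{1}h -mulrA (smuls H) // mulr1.
Qed.

Lemma uK n : u n * u (- n) = 1. Proof. by rewrite (umulu H) subrr u0. Qed.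
Lemma uNK n : u (- n) * u n = 1. Proof. by rewrite (umulu H) addNr u0. Qed.

Lemma ustar n : star (u n) = u (- n).
Proof.
have [h _] := u_unitary H n.
by rewrite -[star _]mulr1 -(uK n) mulrA h mul1r.
Qed.

Lemma ustars m n : m != 0 -> u n * star (s m) = star (s m) * u (m * n).
Proof.
move=> m0; apply: (can_inj (@starK _ _)); rewrite !starM starK !ustar.
by rewrite -mulrN (smulu H).
Qed.

Lemma e_proj m : m != 0 -> is_projection (e m).
Proof.
move=> m0; split; first by rewrite eE starM starK.
by rewrite eE mulrA -(mulrA (s m)) (s_isometry H) // mulr1.
Qed.

Lemma uP a m n : u a * P m n = P m (n + a) * u a.
Proof.
rewrite !PE opprD -!mulrA (umulu H) addrNK !mulrA (umulu H).
by rewrite [a + n]addrC.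
Qed.

Lemma e_star m : star (e m) = e m. Proof. by rewrite eE starM starK. Qed.

Lemma P_star m n : star (P m n) = P m n.
Proof. by rewrite !PE starM starM !ustar opprK e_star mulrA. Qed.

Lemma P_proj m n : m != 0 -> is_projection (P m n).
Proof.
move=> m0; have [es ee] := e_proj m0; split; first exact: P_star.
rewrite !PE !mulrA -(mulrA _ (u (- n)) (u n)) uNK mulr1.
by rewrite -(mulrA (u n)) ee.
Qed.

Lemma eM m k : m != 0 -> k != 0 -> s m * e k * star (s m) = e (m * k).
Proof. by move=> *; rewrite !eE -(smuls H) // starM !mulrA. Qed.

Lemma P_conj m k n : m != 0 -> k != 0 ->
  s m * P k n * star (s m) = P (m * k) (m * n).
Proof.
move=> m0 k0; rewrite !PE -eM // !mulrA (smulu H) // -!mulrA ustars //.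
by rewrite mulrN.
Qed.

Lemma sP m k n : m != 0 -> k != 0 -> s m * P k n = P (m * k) (m * n) * s m.
Proof. by move=> m0 k0; rewrite -P_conj // -!mulrA (s_isometry H) // mulr1. Qed.

Lemma Pstars m k n : m != 0 -> k != 0 ->
  P k n * star (s m) = star (s m) * P (m * k) (m * n).
Proof.
move=> m0 k0; apply: (can_inj (@starK _ _)).
by rewrite !starM starK !P_star sP.
Qed.

Lemma ue m k : m != 0 -> u (m * k) * e m = e m * u (m * k).
Proof.
by move=> m0; rewrite eE mulrA -(smulu H) // -!mulrA ustars.
Qed.

Lemma P_shift m n k : m != 0 -> P m (n + m * k) = P m n.
Proof.
move=> m0; rewrite !PE opprD -(umulu H n) [- n - _]addrC -(umulu H _ (- n)).
rewrite !mulrA -(mulrA (u n)) ue // !mulrA.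
by rewrite -(mulrA _ (u (m * k)) (u (- (m * k)))) uK mulr1.
Qed.

Lemma P_eqmod m n k : m != 0 -> (m %| n - k)%Z -> P m n = P m k.
Proof.
move=> m0 /dvdzP[q E]; have -> : n = k + m * q by rewrite mulrC -E addrC subrK.
exact: P_shift.
Qed.

Lemma P_split m k n : m != 0 -> k != 0 ->
  P m n = \sum_(j < `|k|%N) P (m * k) (n + m * j%:Z).
Proof.
move=> m0 k0; have E := sum_range H k0.
have -> : P m n = u n * (s m * 1 * star (s m)) * u (- n).
    by rewrite mulr1 PE eE.
rewrite -E mulr_sumr mulr_suml mulr_sumr mulr_suml.
apply: eq_bigr => j _; rewrite rpE -PE P_conj // uP.
by rewrite -mulrA uK mulr1 addrC.
Qed.

Lemma e_orth m (i j : 'I_(`|m|%N)) : m != 0 -> i != j -> P m i * P m j = 0.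
Proof.
move=> m0 ij.
apply: (proj_sum_orth (p := fun i : 'I_(`|m|%N) => P m i)) ij => [l|].
  exact: P_proj.
by rewrite -[RHS](sum_range H m0); apply: eq_bigr => l _; rewrite PE eE.
Qed.

Lemma P_orth m n k : m != 0 -> ~~ (m %| n - k)%Z -> P m n * P m k = 0.
Proof.
move=> m0 nk.
have ltm x : (`|(x %% m)%Z|%N < `|m|%N)%N.
  by rewrite -ltz_nat gez0_abs ?modz_ge0 // abszE ltz_mod.
have E x : P m x = P m (Ordinal (ltm x)).
  apply: P_eqmod => //=; rewrite gez0_abs ?modz_ge0 //.
  by rewrite {1}(divz_eq x m) addrK dvdz_mull.
rewrite (E n) (E k); apply: e_orth => //.
apply: contra nk => /eqP/(congr1 val) /= /(congr1 Posz).
rewrite !gez0_abs ?modz_ge0 // => h.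
rewrite {1}(divz_eq n m) {1}(divz_eq k m) h opprD addrACA subrr addr0.
by rewrite -mulrBl dvdz_mull.
Qed.

Lemma P_sub m k n : m != 0 -> k != 0 -> P m n * P (m * k) n = P (m * k) n.
Proof.
move=> m0 k0; rewrite !PE !mulrA -(mulrA _ (u (- n))) uNK mulr1.
rewrite -(mulrA (u n)); congr (_ * _ * _).
by rewrite -eM // eE !mulrA -(mulrA (s m)) (s_isometry H) // mulr1.
Qed.

Lemma P_mul_dvd m k n c : m != 0 -> k != 0 -> (m %| n - c)%Z ->
  P m n * P (m * k) c = P (m * k) c.
Proof. by move=> m0 k0 h; rewrite (P_eqmod m0 h) P_sub. Qed.

Lemma P_mul_ndvd m k n c : m != 0 -> k != 0 -> ~~ (m %| n - c)%Z ->
  P m n * P (m * k) c = 0.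
Proof.
by move=> m0 k0 h; rewrite -(P_sub c m0 k0) mulrA P_orth // mul0r.
Qed.

Lemma P_mulP m n k l : m != 0 -> k != 0 ->
  P m n * P k l = 0 \/
  exists L c, [/\ L != 0, (m %| L)%Z, (k %| L)%Z, (m %| n - c)%Z &
     (k %| l - c)%Z /\ P m n * P k l = P L c].
Proof.
move=> m0 k0; set L := lcmz m k.
have L0 : L != 0 by rewrite -absz_gt0 lcmn_gt0 !absz_gt0 m0.
have /dvdzP[a Ea] : (m %| L)%Z by exact: dvdz_lcml.
have /dvdzP[b Eb] : (k %| L)%Z by exact: dvdz_lcmr.
have a0 : a != 0 by apply: contraNneq L0 => a0; rewrite Ea a0 mul0r.
have b0 : b != 0 by apply: contraNneq L0 => b0; rewrite Eb b0 mul0r.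
rewrite (P_split l k0 b0) mulr_sumr [k * b]mulrC -Eb.
have F (j : 'I_(`|b|%N)) : P m n * P L (l + k * j%:Z) =
    if (m %| n - (l + k * j%:Z))%Z then P L (l + k * j%:Z) else 0.
  rewrite Ea mulrC; case: ifPn => h; first by rewrite P_mul_dvd.
  by rewrite P_mul_ndvd.
have [j0 Hj0|H0] := pickP (fun j : 'I_(`|b|%N) => (m %| n - (l + k * j%:Z))%Z).
  right; exists L, (l + k * j0%:Z); split => //.
  - by exact: dvdz_lcml.
  - by exact: dvdz_lcmr.
  split; first by rewrite opprD addrA subrr sub0r rpredN dvdz_mulr.
  rewrite (bigD1 j0) //= F Hj0 big1 ?addr0 // => j jj0.
  rewrite F; case: ifPn => // Hj; case/eqP: jj0; apply/val_inj/eqP => /=.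
  have mk : (m %| k * (j%:Z - j0%:Z))%Z.
    have -> : k * (j%:Z - j0%:Z) =
      (n - (l + k * j0%:Z)) - (n - (l + k * j%:Z)) by ring.
    exact: rpredB Hj0 Hj.
  have : (L %| k * (j%:Z - j0%:Z))%Z by rewrite dvdzE dvdn_lcm -!dvdzE mk dvdz_mulr.
  rewrite Eb [b * k]mulrC dvdz_mul2l // dvdzE => /dvdn_leq.
  by have := ltn_ord j; have := ltn_ord j0; lia.
by left; rewrite big1 // => j _; rewrite F H0.
Qed.

Lemma P_comm m n k l : m != 0 -> k != 0 -> P m n * P k l = P k l * P m n.
Proof.
move=> m0 k0; have [E|[L [c [L0 _ _ _ [_ E]]]]] := P_mulP n l m0 k0.
  by rewrite -[RHS]starK starM !P_star E star0.
by rewrite -[RHS]starK starM !P_star E P_star.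
Qed.

Lemma TE t : UZ_T u s t <-> t = 0 \/
  exists m m' k n n', [/\ m != 0, m' != 0, k != 0 &
    t = star (s m) * u n * e k * u n' * s m'].
Proof.
by split=> -[->|[m [m' [k [n [n' [m0 m'0 k0 ->]]]]]]]; do ?[by left];
  right; exists m, m', k, n, n'; split=> //; rewrite (eE k).
Qed.

Definition Pset : set A := [set p | p = 0 \/ exists m n, m != 0 /\ p = P m n].

Lemma TsetP t : UZ_T u s t <-> t = 0 \/ exists m m' k n a,
  [/\ m != 0, m' != 0, k != 0 & t = star (s m) * P k n * u a * s m'].
Proof.
have E m m' k n a : star (s m) * P k n * u a * s m' =
    star (s m) * u n * e k * u (a - n) * s m'.
  by rewrite PE !mulrA -(mulrA _ (u (- n))) (umulu H) [- n + a]addrC.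
rewrite TE.
split=> -[->|[m [m' [k [n [a [m0 m'0 k0 ->]]]]]]]; do ?[by left]; right.
  by exists m, m', k, n, (a + n); rewrite E addrK.
by exists m, m', k, n, (a - n); rewrite E.
Qed.

Lemma T0 : UZ_T u s 0. Proof. by left. Qed.

Lemma T1 : UZ_T u s 1.
Proof.
apply/TE; right; exists 1, 1, 1, 0, 0; split=> //.
by rewrite eE u0 !s1 star1 !mulr1.
Qed.

Lemma T_star t : UZ_T u s t -> UZ_T u s (star t).
Proof.
move=> /TE[->|[m [m' [k [n [a [m0 m'0 k0 ->]]]]]]].
  by rewrite star0; left.
apply/TE; right; exists m', m, k, (- a), (- n); split=> //.
by rewrite !starM starK !ustar e_star !mulrA.
Qed.

Lemma s_stars m l : m != 0 -> l != 0 ->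
  s m * star (s l) = star (s l) * e (l * m) * s m.
Proof.
move=> m0 l0; rewrite eE -{1}(smuls H) // [l * m]mulrC -(smuls H) // starM.
rewrite !mulrA (s_isometry H) // mul1r -!mulrA; congr (_ * _).
have -> : star (s l) * (star (s m) * s m) = star (s l).
  by rewrite (s_isometry H) // mulr1.
by [].
Qed.

Lemma e_P m : e m = P m 0.
Proof. by rewrite PE oppr0 u0 mulr1 mul1r. Qed.

Lemma Pset_mul p q : Pset p -> Pset q -> Pset (p * q).
Proof.
case=> [->|[m [n [m0 ->]]]]; first by rewrite mul0r; left.
case=> [->|[k [l [k0 ->]]]]; first by rewrite mulr0; left.
have [->|[L [c [L0 _ _ _ [_ ->]]]]] := P_mulP n l m0 k0; first by left.
by right; exists L, c.
Qed.

Lemma TsetPset m m' p a : m != 0 -> m' != 0 -> Pset p ->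
  UZ_T u s (star (s m) * p * u a * s m').
Proof.
move=> m0 m'0 [->|[k [n [k0 ->]]]]; apply/TsetP.
  by left; rewrite mulr0 !mul0r.
by right; exists m, m', k, n, a.
Qed.

Lemma T_mul t t' : UZ_T u s t -> UZ_T u s t' -> UZ_T u s (t * t').
Proof.
move=> /TsetP[->|[m [m' [k [n [a [m0 m'0 k0 ->]]]]]]].
  by rewrite mul0r; left.
move=> /TsetP[->|[l [l' [h [p [b [l0 l'0 h0 ->]]]]]]].
  by rewrite mulr0; left.
have E : star (s m) * P k n * u a * s m' * (star (s l) * P h p * u b * s l')
  = star (s (l * m)) * (P (l * k) (l * n) * (P (l * m') (l * a)
      * P (m' * h) (m' * p + l * a))) * u (l * a + m' * b) * s (m' * l').
  rewrite !mulrA -(mulrA _ (s m') (star (s l))) s_stars // !mulrA.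
  rewrite -(mulrA _ (u a)) ustars // !mulrA -(mulrA _ (P k n)) Pstars // !mulrA.
  rewrite -starM (smuls H) //.
  rewrite -(mulrA _ (s m') (P h p)) sP // !mulrA.
  rewrite -(mulrA _ (s m') (u b)) (smulu H) // !mulrA.
  rewrite -(mulrA _ (s m') (s l')) (smuls H) //; congr (_ * _).
  rewrite e_P -(umulu H) !mulrA; congr (_ * _).
  rewrite -(mulrA _ (u (l * a))) uP add0r !mulrA.
  by rewrite -(mulrA _ (u (l * a))) uP !mulrA.
rewrite E; apply: TsetPset; rewrite ?mulf_neq0 //.
by apply: Pset_mul; [|apply: Pset_mul]; right;
  [exists (l * k), (l * n) | exists (l * m'), (l * a)
  | exists (m' * h), (m' * p + l * a)]; rewrite mulf_neq0.
Qed.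

Lemma P_inner m k n : m != 0 -> k != 0 -> Pset (star (s m) * P k n * s m).
Proof.
move=> m0 k0.
have -> : star (s m) * P k n * s m = star (s m) * (P m 0 * P k n) * s m.
  by rewrite -e_P eE !mulrA (s_isometry H) // mul1r.
have [->|[L [c [L0 /dvdzP[L' EL] _ + [_ ->]]]]] := P_mulP 0 n m0 k0.
  by left; rewrite mulr0 mul0r.
rewrite sub0r rpredN => /dvdzP[c' Ec].
have L'0 : L' != 0 by apply: contraNneq L0 => L'0; rewrite EL L'0 mul0r.
right; exists L', c'; split => //.
by rewrite EL Ec ![_ * m]mulrC -mulrA -sP // mulrA (s_isometry H) // mul1r.
Qed.

Lemma T_range t : UZ_T u s t -> Pset (t * star t).
Proof.
move=> /TsetP[->|[m [m' [k [n [a [m0 m'0 k0 ->]]]]]]].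
  by left; rewrite mul0r.
have -> : star (s m) * P k n * u a * s m' * star (star (s m) * P k n * u a * s m')
   = star (s m) * (P k n * P m' a * P k n) * s m.
  rewrite !starM starK ustar P_star !mulrA; congr (_ * _ * _).
  by rewrite -(mulrA _ (s m')) -eE -!mulrA [u a * (_ * _)]mulrA -PE.
have : Pset (P k n * P m' a * P k n).
  by do ?apply: Pset_mul; right; [exists k, n|exists m', a|exists k, n].
case=> [->|[L [c [L0 ->]]]]; last exact: P_inner.
by left; rewrite mulr0 mul0r.
Qed.

Lemma T_pisom t : UZ_T u s t -> t * star t * t = t.
Proof.
move=> /TsetP[->|[m [m' [k [n [a [m0 m'0 k0 ->]]]]]]].
  by rewrite mulr0.
set p := P k n; set q := P m' a.
have [v ev] : exists v, v = u a * s m' by exists (u a * s m').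
have pp : p * p = p by have [] := P_proj n k0.
have vv : v * star v = q.
  by rewrite ev starM ustar /q PE eE !mulrA.
have qv : q * v = v.
  rewrite -vv ev starM -!mulrA (mulrA (star (u a))) ustar uNK mul1r.
  by rewrite (s_isometry H) // mulr1.
have se : star (s m) * P m 0 = star (s m).
  by rewrite -e_P eE mulrA (s_isometry H) // mul1r.
rewrite -(mulrA _ (u a)) -ev 2!starM starK P_star.
have -> : star (s m) * p * v * (star v * (p * s m)) * (star (s m) * p * v)
  = star (s m) * (p * q * p * P m 0 * p) * v.
  by rewrite -vv -e_P eE !mulrA.
have -> : p * q * p * P m 0 * p = P m 0 * (p * q).
  rewrite -!mulrA (P_comm 0 n m0 k0) (mulrA p p) pp (P_comm n 0 k0 m0).
  rewrite (mulrA q) (P_comm a 0 m'0 m0) -mulrA (mulrA p) (P_comm n 0 k0 m0).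
  by rewrite -mulrA (P_comm a n m'0 k0) (mulrA p p) pp.
by rewrite !mulrA se -mulrA qv.
Qed.

Lemma T_idem_proj t : UZ_T u s t -> t * t = t -> Pset t.
Proof.
move=> Tt tt; have pi := T_pisom Tt; have pi' := T_pisom (T_star Tt).
suff -> : t = (t * star t) * (star t * t).
  apply: Pset_mul; first exact: T_range.
  by rewrite -{2}[t]starK; apply: T_range; apply: T_star.
by rewrite !mulrA -(mulrA t) -starM tt pi.
Qed.

Lemma Pset_comm p q : Pset p -> Pset q -> p * q = q * p.
Proof.
case=> [->|[m [n [m0 ->]]]]; first by rewrite mul0r mulr0.
case=> [->|[k [l [k0 ->]]]]; first by rewrite mul0r mulr0.
exact: P_comm.
Qed.

Lemma T_inverse t t' : UZ_T u s t -> UZ_T u s t' ->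
  t * t' * t = t /\ t' * t * t' = t' <-> t' = star t.
Proof.
move=> Tt Tt'; have pi := T_pisom Tt; have pi' := T_pisom (T_star Tt).
rewrite starK in pi'; split=> [[h1 h2]|-> //].
have i1 : Pset (t * t').
  by apply: T_idem_proj; [exact: T_mul | rewrite mulrA h1].
have i2 : Pset (t' * t).
  by apply: T_idem_proj; [exact: T_mul | rewrite mulrA h2].
have j1 : Pset (t * star t) by exact: T_range.
have j2 : Pset (star t * t) by rewrite -{2}[t]starK; apply/T_range/T_star.
have -> : t' = (t' * t) * (star t * t) * t'.
  by rewrite -mulrA -(mulrA t') !(mulrA t) pi mulrA h2.
rewrite (Pset_comm i2 j2) -!mulrA (mulrA t') h2.
have -> : star t * (t * t') = star t * ((t * star t) * (t * t')).
  by rewrite !mulrA pi'.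
by rewrite (Pset_comm j1 i1) [t * t' * _]mulrA h1 mulrA pi'.
Qed.

End UZTheory.

Section UZInverseSemigroup.
Variables (R : realType) (A : cstarAlgebra R) (u s : int -> A).
Hypothesis H : UZ_relations u s.
Let e := range_proj s.
Let eE m : e m = s m * star (s m) := erefl.
Let PE m n : u n * e m * u (- n) = u n * e m * u (- n) := erefl.

Lemma UZ_T0 : UZ_T u s 0. Proof. by left. Qed.
Lemma UZ_T1 : UZ_T u s 1. Proof. exact: (T1 H eE). Qed.
Lemma UZ_T_star t : UZ_T u s t -> UZ_T u s (star t).
Proof. exact: (T_star H eE). Qed.
Lemma UZ_T_mul t t' : UZ_T u s t -> UZ_T u s t' -> UZ_T u s (t * t').
Proof. exact: (T_mul H eE PE). Qed.
Lemma UZ_T_pisom t : UZ_T u s t -> partial_isometry t.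
Proof. exact: (T_pisom H eE PE). Qed.
Lemma UZ_T_inverse t t' : UZ_T u s t -> UZ_T u s t' ->
  t * t' * t = t /\ t' * t * t' = t' <-> t' = star t.
Proof. exact: (T_inverse H eE PE). Qed.

End UZInverseSemigroup.

(* A C*-algebra generated by families satisfying the relations and universal
   for them; these data determine it up to isomorphism.  The morphism [phi] is
   unique because [UZ_u] and [UZ_s] generate. *)
Record UZ (R : realType) := MkUZ {
  UZ_algebra :> cstarAlgebra R;
  UZ_u : int -> UZ_algebra;
  UZ_s : int -> UZ_algebra;
  UZ_rel : UZ_relations UZ_u UZ_s;
  UZ_generated :
    cstar_gen (range UZ_u `|` [set UZ_s m | m in [set m | m != 0]]) = setT;
  UZ_universal : forall (B : cstarAlgebra R) (u s : int -> B),
    UZ_relations u s ->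
    exists phi : {lrmorphism UZ_algebra -> B},
      [/\ forall a, phi (star a) = star (phi a),
          forall n, phi (UZ_u n) = u n &
          forall m, m != 0 -> phi (UZ_s m) = s m]
}.

Definition UZ_semigroup (R : realType) (U : UZ R) : Type :=
  {t : U | `[< UZ_T (@UZ_u R U) (@UZ_s R U) t >]}.

Section UZSemigroup.
Variables (R : realType) (U : UZ R).
Local Notation T := (UZ_semigroup U).
Local Notation inT := (UZ_T (@UZ_u R U) (@UZ_s R U)).

HB.instance Definition _ := [isSub for @sval U (fun t => `[< inT t >]) : T -> U].
HB.instance Definition _ := [Choice of T by <:].

Definition UZ_elt (t : U) (Ht : inT t) : T := exist _ t (asboolT Ht).

Lemma UZ_eltP (x : T) : inT (val x). Proof. exact/asboolP/(valP x). Qed.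

Definition T_mul_op (x y : T) : T :=
  UZ_elt (UZ_T_mul (UZ_rel U) (UZ_eltP x) (UZ_eltP y)).
Definition T_one : T := UZ_elt (UZ_T1 (UZ_rel U)).
Definition T_zero : T := UZ_elt (UZ_T0 (@UZ_u R U) (@UZ_s R U)).
Definition T_inv (x : T) : T := UZ_elt (UZ_T_star (UZ_rel U) (UZ_eltP x)).

Fact T_mulA : associative T_mul_op.
Proof. by move=> x y z; apply: val_inj; exact: mulrA. Qed.
Fact T_mul1 : left_id T_one T_mul_op.
Proof. by move=> x; apply: val_inj; exact: mul1r. Qed.
Fact T_mulr1 : right_id T_one T_mul_op.
Proof. by move=> x; apply: val_inj; exact: mulr1. Qed.

HB.instance Definition _ := isMonoid.Build T T_mulA T_mul1 T_mulr1.

Fact T_mul0 (x : T) : (T_zero * x)%g = T_zero.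
Proof. by apply: val_inj; exact: mul0r. Qed.
Fact T_mulr0 (x : T) : (x * T_zero)%g = T_zero.
Proof. by apply: val_inj; exact: mulr0. Qed.
Fact T_invP (x y : T) :
  ((x * y * x = x) /\ (y * x * y = y) <-> y = T_inv x)%g.
Proof.
have h := UZ_T_inverse (UZ_rel U) (UZ_eltP x) (UZ_eltP y).
split=> [[h1 h2]|E].
  apply: val_inj; apply/h; split; first exact: (congr1 (fun z : T => val z) h1).
  exact: (congr1 (fun z : T => val z) h2).
by have [h1 h2] := h.2 (congr1 (fun z : T => val z) E); split; apply: val_inj.
Qed.

HB.instance Definition _ :=
  Monoid_isInverseSemigroup.Build T T_mul0 T_mulr0 T_invP.

Definition UZ_inclusion : semigroup_rep T U :=
  @SemigroupRep T R U (fun x : T => val x)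
    (fun x => UZ_T_pisom (UZ_rel U) (UZ_eltP x))
    (fun _ _ => erefl) (fun _ => erefl) erefl erefl.

End UZSemigroup.

(* Main.v *)
Require Import Defs.
From mathcomp Require Import all_boot all_order all_algebra.
From mathcomp Require Import complex classical_sets reals.

Set Implicit Arguments.
Unset Strict Implicit.
Unset Printing Implicit Defensive.

Import Order.TTheory GRing.Theory.

Local Open Scope classical_set_scope.
Local Open Scope ring_scope.

(** The non-zero projections of [T] are attached to the cosets [n + mZ], and the
relations of [U[Z]] make them behave like the cosets themselves: [n + mZ] is the
disjoint union of the [|k|] cosets of modulus [mk] that it contains, and each of
these is either contained in, or disjoint from, any given coset whose modulus
divides [mk].

Given a finite cover [Z] of [[0, x]], with [x] the projection of [n + mZ],
choose [k] such that the moduli of all non-zero members of [Z] divide [mk]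
([refinement_dichotomy]).  Each piece of [x] of modulus [mk] lies in [T] and
below [x], so, if non-zero, it meets a member of [Z]; it then lies below that
member, hence below the supremum of [Z].  As [x] is the sum of its pieces
([P_split]), it lies below the supremum as well ([le_finite_cover_join]); the
other inequality holds because the members of [Z] lie below [x]. *)

Section CosetProjections.
Variables (R : realType) (A : cstarAlgebra R) (u s : int -> A).
Hypothesis H : UZ_relations u s.

Definition coset_proj (m n : int) : A := u n * range_proj s m * u (- n).

Let e := range_proj s.
Let eE m : e m = s m * star (s m) := erefl.
Let PE m n : coset_proj m n = u n * e m * u (- n) := erefl.

Lemma Pset_UZ_T p : Pset coset_proj p -> UZ_T u s p.
Proof.
move=> /(TsetPset H eE PE 0 (oner_neq0 _) (oner_neq0 _)).
by rewrite (u0 H) (s1 H) star1 !mulr1 mul1r.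
Qed.

(** One modulus works for all members of [zs]: the product of [m] with the moduli
of the non-zero members, because a coset of modulus [a] contains or misses every
coset whose modulus is a multiple of [a]. *)
Lemma refinement_dichotomy (m : int) (zs : seq A) :
  m != 0 -> (forall z, z \in zs -> Pset coset_proj z) ->
  exists2 k, k != 0 & forall z c, z \in zs ->
    z * coset_proj (m * k) c = coset_proj (m * k) c \/
    z * coset_proj (m * k) c = 0.
Proof.
elim: zs m => [|z zs IH] m m0 Pz; first by exists 1.
have Pzs w : w \in zs -> Pset coset_proj w.
  by move=> wz; apply: Pz; rewrite in_cons wz orbT.
have [z0|[a [n [a0 zE]]]] := Pz z (mem_head _ _).
  have [k k0 Hk] := IH m m0 Pzs; exists k => // w c.
  by rewrite in_cons => /predU1P[->|/Hk//]; right; rewrite z0 mul0r.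
have [k k0 Hk] := IH (m * a) (mulf_neq0 m0 a0) Pzs.
exists (a * k); first exact: mulf_neq0.
move=> w c; rewrite in_cons [m * (a * k)]mulrA => /predU1P[->|/Hk//].
rewrite zE [m * a]mulrC -[a * m * k]mulrA; have mk0 := mulf_neq0 m0 k0.
have [h|h] := boolP (a %| n - c)%Z.
  by left; exact: (P_mul_dvd H eE PE a0 mk0 h).
by right; exact: (P_mul_ndvd H eE PE a0 mk0 h).
Qed.

End CosetProjections.

Section Tightness.
Variables (R : realType) (U : UZ R).
Local Notation P := (coset_proj (@UZ_u R U) (@UZ_s R U)).
Local Notation E := (idempotents (UZ_semigroup U)).
Local Notation sigma := (rep_idem (UZ_inclusion U)).

Lemma idem_Pset (x : E) : Pset P (val (val x)).
Proof.
apply: (T_idem_proj (UZ_rel U) (fun=> erefl) (fun _ _ => erefl)).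
  exact: UZ_eltP.
by have /(congr1 val) := idemP x.
Qed.

Lemma Pset_idem (p : U) : Pset P p -> exists y : E, val (val y) = p.
Proof.
move=> Pp.
pose t : UZ_semigroup U := UZ_elt (Pset_UZ_T (UZ_rel U) Pp).
have tt : (t * t = t)%g.
  apply: val_inj => /=; have [->|[m [n [m0 ->]]]] := Pp; first by rewrite mul0r.
  by have [] := P_proj (UZ_rel U) (fun=> erefl) (fun _ _ => erefl) n m0.
by exists (Idempotent tt).
Qed.

Lemma idem_leP (x y : E) :
  reflect (val (val y) * val (val x) = val (val x)) (x <= y)%O.
Proof.
rewrite leEmeet meetC; apply: (iffP eqP) => [/(congr1 val)/(congr1 val) //|h].
by apply: val_inj; apply: val_inj.
Qed.

Lemma sigma_le (x y : E) : (x <= y)%O -> (sigma x <= sigma y)%O.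
Proof. by move=> /meet_idPl h; rewrite leEmeet -srepI h. Qed.

(** A piece of [x] whose modulus is a multiple of the moduli of the non-zero
members of [Z] lies below every member that it meets, and a cover provides such
a member as soon as the piece is non-zero. *)
Lemma le_finite_cover_join (x : E) (Z : seq E) :
  is_cover [set z | (z <= x)%O] [set` Z] ->
  (sigma x <= \join_(z <- Z) sigma z)%O.
Proof.
move=> [_ Zcov]; set J := (\join_(z <- Z) sigma z)%O.
suff h : val (val x) * val J = val (val x) by rewrite leEmeet; apply/eqP/val_inj.
have [->|[m [n [m0 xE]]]] := idem_Pset x; first by rewrite mul0r.
pose zs : seq U := [seq val (val z) | z : E <- Z].
have zsP z : z \in zs -> Pset P z by move=> /mapP[w _ ->]; exact: idem_Pset.
have [k k0 Hk] := refinement_dichotomy (UZ_rel U) m0 zsP.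
have mk0 := mulf_neq0 m0 k0.
have xsum : P m n = \sum_(j < `|k|%N) P (m * k) (n + m * j%:Z).
  exact: (P_split (UZ_rel U) (fun=> erefl) (fun _ _ => erefl) n m0 k0).
rewrite xE xsum mulr_suml; apply: eq_bigr => j _.
set c := n + m * j%:Z.
have [y yE] : exists y : E, val (val y) = P (m * k) c.
  by apply: Pset_idem; right; exists (m * k), c.
have [y0|ynz] := eqVneq y \bot%O; first by rewrite -yE y0 mul0r.
have yx : (y <= x)%O.
  apply/idem_leP; rewrite xE yE.
  apply: (P_mul_dvd (UZ_rel U) (fun=> erefl) (fun _ _ => erefl)) => //.
  by rewrite /c opprD addrA subrr sub0r rpredN dvdz_mulr.
have [f fZ fy] := Zcov y yx ynz.
have yf : (y <= f)%O.
  have fzs : val (val f) \in zs by exact: (map_f (fun z : E => val (val z)) fZ).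
  apply/idem_leP; rewrite yE.
  have [//|f0] := Hk _ c fzs; case/eqP: fy.
  by apply: val_inj; apply: val_inj; rewrite /= yE f0.
have yJ : (sigma y <= J)%O.
  apply: le_trans (sigma_le yf) _; exact: joins_sup_seq.
by move: yJ; rewrite leEmeet => /eqP/(congr1 val); rewrite -yE.
Qed.

End Tightness.

Theorem proposition3p7 (R : realType) (U : UZ R) : tight (UZ_inclusion U).
Proof.
move=> x Z Zcov; apply/le_anti; rewrite le_finite_cover_join // andbT.
by have [Zx _] := Zcov; apply/joinsP_seq => z zZ _; apply: sigma_le; exact: Zx.
Qed.
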